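(* Let $L$ be a bounded lattice, $\to$ a preconditional on $L$, and $\neg$ an antitone unary operation on $L$ such that $a\to0\le\neg a$ for all $a\in L$. Let $P=\{(x,x\to y)\mid x,y\in L\}$, define $\vartriangleleft$ on $P$ by $(a,b)\vartriangleleft(c,d)$ iff $c\not\le b$, and define $\blacktriangleleft$ on $P$ by $(x',x'\to y')\blacktriangleleft(x,x\to y)$ iff $(x',x'\to y')\vartriangleleft(x,x\to y)$ and for all $a\in L$, $x\le\neg a$ implies $x'\not\le a$. Then there is a complete embedding of $(L,\to,\neg)$ into $(\mathfrak{L}(P,\vartriangleleft),\twoheadrightarrow_\vartriangleleft,\neg_\blacktriangleleft)$, which is an isomorphism if $L$ is complete.
   Context: A preconditional on a bounded lattice $L$ is a binary operation $\to$ such that for all $a,b,c$: (1) $1\to a\le a$; (2) $a\wedge b\le a\to b$; (3) $a\to b\le a\to(a\wedge b)$; (4) if $b\le a$ then $a\to(b\to c)\le b\to c$; (5) if $b\le c$ then $a\to b\le a\to c$. Antitone: $a\le b\Rightarrow\neg b\le\neg a$. For a nonempty set $X$ with binary relation $\vartriangleleft$ (write $y\vartriangleright x$ for $x\vartriangleleft y$): $c_\vartriangleleft(A)=\{x\mid\forall x'\vartriangleleft x\ \exists x''\vartriangleright x':x''\in A\}$; $\mathfrak{L}(X,\vartriangleleft)$ is the complete lattice of $c_\vartriangleleft$-fixpoints ordered by inclusion (meets are intersections, joins are $c_\vartriangleleft$ of unions); $A\twoheadrightarrow_\vartriangleleft B=\{x\mid\forall y\vartriangleleft x\,(y\in A\Rightarrow\exists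 z\vartriangleright y: z\in A\cap B)\}$; for a relation $\blacktriangleleft$ on $X$, $\neg_\blacktriangleleft A=\{x\mid\forall y\blacktriangleleft x,\ y\notin A\}$. A complete embedding is an injective map preserving all existing meets and joins and commuting with the extra operations. *)

(* Defs.v *)
From HB Require Import structures.
From mathcomp Require Export all_boot all_order.
From mathcomp Require Export boolp classical_sets.

Set Implicit Arguments.
Unset Strict Implicit.
Unset Printing Implicit Defensive.

Import Order.TTheory.
Local Open Scope order_scope.
Local Open Scope classical_set_scope.

Record preconditional d (L : tbLatticeType d) (imp : L -> L -> L) : Prop := {
  precond_top : forall a, imp \top a <= a;
  precond_meet : forall a b, (a `&` b)%O <= imp a b;
  precond_idem : forall a b, imp a b <= imp a (a `&` b)%O;
  precond_weak : forall a b c, b <= a -> imp a (imp b c) <= imp b c;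
  precond_mono : forall a b c, b <= c -> imp a b <= imp a c
}.

Definition antitone d (L : porderType d) (neg : L -> L) : Prop :=
  {homo neg : a b / a <= b >-> b <= a}.

Definition complete_lattice d (L : porderType d) : Prop :=
  forall S : set L, infimums S !=set0 /\ supremums S !=set0.

(* Only the infima and suprema existing in [L] have to be preserved; taking
   [S] empty or a pair covers the bounds and the binary operations. *)
Record complete_embedding d d' (L : porderType d) (M : porderType d')
    (imp : L -> L -> L) (neg : L -> L) (imp' : M -> M -> M) (neg' : M -> M)
    (e : L -> M) : Prop := {
  cemb_inj : injective e;
  cemb_inf : forall (S : set L) m, infimums S m -> infimums (e @` S) (e m);
  cemb_sup : forall (S : set L) m, supremums S m -> supremums (e @` S) (e m);
  cemb_imp : {morph e : a b / imp a b >-> imp' a b};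
  cemb_neg : {morph e : a / neg a >-> neg' a}
}.

Section RelationalFrame.
Variables (X : Type) (lhd : X -> X -> Prop).
Implicit Types A B : set X.

Definition clos A : set X :=
  [set x | forall x', lhd x' x -> exists2 x'', lhd x' x'' & A x''].

Definition rel_imp A B : set X :=
  [set x | forall y, lhd y x -> A y -> exists2 z, lhd y z & (A `&` B) z].

Definition rel_neg (brel : X -> X -> Prop) A : set X :=
  [set x | forall y, brel y x -> ~ A y].

Lemma sub_clos A : A `<=` clos A.
Proof. by move=> x Ax x' lx'; exists x. Qed.

Lemma clos_mono A B : A `<=` B -> clos A `<=` clos B.
Proof. by move=> AB x cA x' /cA[x'' ? /AB]; exists x''. Qed.

Lemma clos_idem A : clos (clos A) = clos A.
Proof.
apply/seteqP; split=> [x cc x' lx'|]; last exact: sub_clos.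
by have [x'' lx'' /(_ _ lx'')] := cc _ lx'.
Qed.

Lemma clos_rel_imp A B : clos (rel_imp A B) = rel_imp A B.
Proof.
apply/seteqP; split=> [x c y ly Ay|]; last exact: sub_clos.
by have [z lz /(_ _ lz Ay)] := c _ ly.
Qed.

Record fixpoints := Fixpoints {
  fix_set :> set X;
  fix_setP : clos fix_set == fix_set
}.

HB.instance Definition _ := [isSub of fixpoints for fix_set].
HB.instance Definition _ := [Choice of fixpoints by <:].
HB.instance Definition _ :=
  [SubChoice_isSubPOrder of fixpoints by <: with set_display].

Lemma clos_fix (A : fixpoints) : clos A = A.
Proof. exact/eqP/fix_setP. Qed.

Lemma fix_leE (A B : fixpoints) : (A <= B) = (fix_set A `<=` fix_set B) :> Prop.
Proof. by rewrite -subsetEset -Order.le_val. Qed.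

Definition mk_fix A (cA : clos A = A) : fixpoints := Fixpoints (introT eqP cA).

Definition fix_imp (A B : fixpoints) : fixpoints :=
  mk_fix (clos_rel_imp A B).

(* Unlike [rel_imp], [rel_neg] does not send fixpoints to fixpoints for an
   arbitrary relation, hence the explicit closure condition. *)
Definition neg_closed (brel : X -> X -> Prop) : Prop :=
  forall A : fixpoints, clos (rel_neg brel A) = rel_neg brel A.

Definition fix_neg brel (cN : neg_closed brel) (A : fixpoints) : fixpoints :=
  mk_fix (cN A).

Lemma clos_bigcap (S : set fixpoints) :
  clos (\bigcap_(A in S) fix_set A) = \bigcap_(A in S) fix_set A.
Proof.
apply/seteqP; split; last exact: sub_clos.
move=> x cx A SA; rewrite -clos_fix; apply: clos_mono cx => y; exact.
Qed.

Definition fix_meet (S : set fixpoints) : fixpoints := mk_fix (clos_bigcap S).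

Definition fix_join (S : set fixpoints) : fixpoints :=
  mk_fix (clos_idem (\bigcup_(A in S) fix_set A)).

Lemma fix_meetP (S : set fixpoints) : infimums S (fix_meet S).
Proof.
split=> [A SA|B lbB]; rewrite fix_leE => x; first exact.
by move=> Bx A SA; have := lbB A SA; rewrite fix_leE; apply.
Qed.

Lemma fix_joinP (S : set fixpoints) : supremums S (fix_join S).
Proof.
split=> [A SA|B ubB]; rewrite fix_leE.
  by move=> x Ax; apply: sub_clos; exists A.
rewrite -[fix_set B]clos_fix; apply: clos_mono => x [A SA Ax].
by have := ubB A SA; rewrite fix_leE; apply.
Qed.

Lemma fixpoints_complete : complete_lattice fixpoints.
Proof.
by move=> S; split; [exists (fix_meet S); apply: fix_meetP
                    |exists (fix_join S); apply: fix_joinP].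
Qed.

End RelationalFrame.

Section PairFrame.
Variables (d : Order.disp_t) (L : tbLatticeType d).
Variables (imp : L -> L -> L) (neg : L -> L).

Definition pairs : set (L * L) := [set (x, imp x y) | x in setT & y in setT].

Definition pair_lhd (p q : pairs) : Prop := ~ ((val q).1 <= (val p).2).

Definition pair_blhd (p q : pairs) : Prop :=
  pair_lhd p q /\
  forall a : L, (val q).1 <= neg a -> ~ ((val p).1 <= a).

End PairFrame.

(* Main.v *)
(* Since [imp \top m = m], every element of [L] is a second component of a
   point, and for [p = (c, imp c y)] the relation [pair_lhd p q] only says that
   the first component of [q] is not below [imp c y].  So the fixpoints are the
   sets of points whose first component is below all upper bounds of some subset
   of [L]: they form the MacNeille completion of [L], embedded by
   [a |-> {p | p.1 <= a}].  As [imp c \bot <= neg c] and [imp c \bot] is the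
   least second component over [c], [rel_neg] of [A] consists of the points [q]
   with [q.1 <= neg p.1] for all [p] in [A], whence its closedness. *)
Require Import Defs.
From mathcomp Require Import all_boot all_order boolp classical_sets.
Local Open Scope order_scope.

Import Order.TTheory.

Section PairFrame.
Set Implicit Arguments.
Unset Strict Implicit.
Variables (d : Order.disp_t) (L : tbLatticeType d).
Variables (imp : L -> L -> L) (neg : L -> L).
Hypothesis himp : preconditional imp.

Local Notation pts := (pairs imp).
Local Notation lhd := (@pair_lhd d L imp).
Local Notation blhd := (@pair_blhd d L imp neg).
Local Notation fixp := (fixpoints lhd).

Lemma imp_top a : imp \top a = a.
Proof.
apply/le_anti; rewrite (precond_top himp) /=.
by have := precond_meet himp \top a; rewrite meet1x.
Qed.

Definition point (x y : L) : pts :=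
  exist _ (x, imp x y) (mem_set (ex_intro2 _ _ x I (ex_intro2 _ _ y I erefl))).

Lemma pointP (p : pts) : exists y, (val p).2 = imp (val p).1 y.
Proof. by have [x _ [y _ <-]] := set_mem (valP p); exists y. Qed.

Lemma not_lhdE (p q : pts) : ~ lhd p q <-> (val q).1 <= (val p).2.
Proof. by split=> [/contrapT|? []]. Qed.

(** An upper bound [m] is tested at [point \top m], whose second component is [m]. Conversely, if
    [p] is related to no point of [A], its second component is itself such an upper bound. *)
Lemma closP (A : set pts) (q : pts) :
  clos lhd A q <->
  (forall m, (forall p, A p -> (val p).1 <= m) -> (val q).1 <= m).
Proof.
split=> [cq m ubm|cq p lpq].
  apply: contrapT => qm; have lq : lhd (point \top m) q.
    by rewrite /pair_lhd /= imp_top.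
  have [r] := cq _ lq; rewrite /pair_lhd /= imp_top => rm Ar.
  exact/rm/ubm.
apply: contrapT => nex; apply: lpq; apply: cq => r Ar.
by apply/not_lhdE => lpr; apply: nex; exists r.
Qed.

Definition down (a : L) : set pts := fun p => (val p).1 <= a.

Lemma clos_down a : clos lhd (down a) = down a.
Proof.
apply/seteqP; split=> [q /closP cq|]; last exact: sub_clos.
by apply: cq.
Qed.

Definition embed (a : L) : fixp := mk_fix (clos_down a).

Lemma fix_ubound (A : fixp) (q : pts) :
  (forall m, (forall p, fix_set A p -> (val p).1 <= m) -> (val q).1 <= m) ->
  fix_set A q.
Proof. by move=> ubq; rewrite -(clos_fix A); apply/closP. Qed.

Lemma embed_le (A : fixp) a :
  A <= embed a <-> (forall p, fix_set A p -> (val p).1 <= a).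
Proof. by rewrite fix_leE; split. Qed.

Lemma embed_inj : injective embed.
Proof.
suff embed_le_inv a b : embed a = embed b -> a <= b.
  by move=> a b eab; apply/le_anti; rewrite !embed_le_inv.
move=> eab; have /embed_le : embed a <= embed b by rewrite eab.
by move=> /(_ (point a a)); apply; apply: lexx.
Qed.

Lemma embed_homo a b : a <= b -> embed a <= embed b.
Proof. by move=> ab; apply/embed_le => p pa; apply: le_trans ab. Qed.

Lemma embed_inf (S : set L) m :
  infimums S m -> infimums (image S embed) (embed m).
Proof.
move=> [lbm glbm]; split=> [_ [a Sa <-]|B lbB]; first exact/embed_homo/lbm.
apply/embed_le => p Bp; apply: glbm => a Sa.
by have /embed_le : B <= embed a by [apply: lbB; exists a]; apply.
Qed.

Lemma embed_sup (S : set L) m :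
  supremums S m -> supremums (image S embed) (embed m).
Proof.
move=> [ubm lubm]; split=> [_ [a Sa <-]|B ubB]; first exact/embed_homo/ubm.
rewrite fix_leE => q qm; apply: fix_ubound => n ubn.
(* [B] contains [point a a] for each [a] in [S], so [n] bounds [S]. *)
apply: (le_trans qm); apply: lubm => a Sa; apply: (ubn (point a a)).
have := ubB (embed a); rewrite fix_leE; apply; last exact: lexx.
by exists a.
Qed.

Lemma embed_imp : {morph embed : a b / imp a b >-> fix_imp a b}.
Proof.
move=> a b; apply/val_inj/seteqP; split=> q /= qab.
  move=> p lpq pa; apply: contrapT => nex; apply: lpq.
  have [y py] := pointP p; rewrite py.
  (* Under this bound, [imp a b] lies below [imp a (imp p.1 y)], and so below [imp p.1 y] because
     [p.1 <= a]. *)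
  suff ab_le : (a `&` b)%O <= imp (val p).1 y.
    apply: (le_trans qab); apply: (le_trans (precond_idem himp a b)).
    apply: (le_trans (precond_mono himp a ab_le)).
    exact: precond_weak.
  (* Any point over the meet would serve; its second component is immaterial. *)
  rewrite -py; apply: (not_lhdE p (point (a `&` b)%O a)).1 => lp.
  apply: nex; exists (point (a `&` b)%O a) => //.
  by split; [apply: leIl|apply: leIr].
apply: contrapT => nqab.
(* The second component of [point a b] is [imp a b], which bounds the meet and hence [z.1]. *)
have [z lz [za zb]] := qab (point a b) nqab (lexx a).
apply: lz => /=; apply: le_trans (precond_meet himp a b).
by rewrite lexI za zb.
Qed.

(** The preimage is the supremum of the first components of [A], which lies below all their upper
    bounds. *)
Lemma embed_surj (A : fixp) : complete_lattice L -> exists a, embed a = A.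
Proof.
move=> /(_ (image (fix_set A) (fun p => (val p).1)))[_ [a [uba luba]]].
exists a; apply/le_anti/andP; split; last first.
  by apply/embed_le => p Ap; apply: uba; exists p.
rewrite fix_leE => q qa; apply: fix_ubound => m ubm.
by apply: (le_trans qa); apply: luba => _ [p Ap <-]; apply: ubm.
Qed.

Lemma embed_bij : complete_lattice L -> bijective embed.
Proof.
move=> cL; have [g gK] := choice (fun A => embed_surj A cL).
by exists g => // a; apply: embed_inj.
Qed.

Hypothesis hneg : antitone neg.
Hypothesis h0 : forall a : L, imp a \bot <= neg a.

Lemma rel_negP (A : fixp) (q : pts) :
  rel_neg blhd A q <->
  (forall p, fix_set A p -> (val q).1 <= neg (val p).1).
Proof.
split=> [nq p Ap|nq p [_ npq] Ap]; last by apply: (npq _ (nq p Ap)).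
(* The point [p] itself need not be related to [q]. Lowering its second component to [imp p.1 \bot]
   forces the relation through [h0] and keeps it in [A], where membership depends only on the first
   component. *)
apply: contrapT => qp; apply: (nq (point (val p).1 \bot)); first split.
- by move=> /= q0; apply: qp; apply: le_trans (h0 _).
- by move=> a qa /= pa; apply: qp; apply: (le_trans qa); apply: hneg.
- by apply: fix_ubound => m ubm; apply: (ubm p Ap).
Qed.

Lemma rel_neg_closed : neg_closed lhd blhd.
Proof.
move=> A; apply/seteqP; split=> [q /closP cq|]; last exact: sub_clos.
by apply/rel_negP => p Ap; apply: cq => r /rel_negP; apply.
Qed.

Lemma embed_neg : {morph embed : a / neg a >-> fix_neg rel_neg_closed a}.
Proof.
move=> a; apply/val_inj/seteqP; split=> q /=.
  move=> qa; apply/(rel_negP (embed a)) => p pa.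
  by apply: (le_trans qa); apply: hneg.
by move=> /(rel_negP (embed a))/(_ (point a a)); apply; apply: lexx.
Qed.

End PairFrame.

Theorem theorem6p4 (d : Order.disp_t) (L : tbLatticeType d)
    (imp : L -> L -> L) (neg : L -> L)
    (himp : preconditional imp) (hneg : antitone neg)
    (h0 : forall a : L, imp a \bot <= neg a) :
  exists (cN : neg_closed (@pair_lhd d L imp) (@pair_blhd d L imp neg))
         (e : L -> fixpoints (@pair_lhd d L imp)),
    complete_embedding imp neg
      (@fix_imp _ (@pair_lhd d L imp)) (fix_neg cN) e /\
    (complete_lattice L -> bijective e).
Proof.
exists (rel_neg_closed himp hneg h0), (embed himp).
split; last exact: embed_bij.
split.
- exact: embed_inj.
- exact: embed_inf.
- exact: embed_sup.
- exact: embed_imp.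
- exact: embed_neg.
Qed.
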